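(* Let $\alpha$ be a $\Sigma_2$-sentence of the language $\mathcal{L}_A\cup\{P\}$ such that $\alpha$ has a standard model and the only non-logical, non-arithmetical symbol occurring in $\alpha$ is the unary relation symbol $P$. Then $\mathrm{Th}(\mathbb{N})+\alpha$ is not a theory of truth for $\mathcal{L}_A$.
   Context: $\mathcal{L}_A$ is the first-order language with equality of signature $\langle 0,1,+,\times,<\rangle$. For a language extending $\mathcal{L}_A$, $\Delta_0$ formulae are those built from atomic formulae by connectives and bounded quantifiers; $\Sigma_2$ formulae are of the form $\exists\bar x\forall\bar y\,\delta$ with $\delta\in\Delta_0$ (here $\delta$ may contain $P$). $\alpha$ has a standard model if the standard model $\mathbb{N}$ of arithmetic can be expanded, by interpreting the additional symbols, to a model of $\alpha$. $\mathrm{Th}(\mathbb{N})$ is the set of $\mathcal{L}_A$-sentences true in $\mathbb{N}$. $\mathrm{EA}$ is $\mathrm{PA}^-$ (nonnegative parts of discretely ordered rings) + induction for $\Delta_0$ formulae of $\mathcal{L}_A$ + totality of exponentiation. A theory of truth for $\mathcal{L}_A$ is a consistent theory $Th$ containing $\mathrm{EA}$ for which there is a formula $\Theta(x)$ of its language with one free variable such that $Th\vdash\Theta(\ulcorner\sigma\urcorner)\leftrightarrow\sigma$ for every $\mathcal{L}_A$-sentence $\sigma$, where $\ulcorner\sigma\urcorner$ is the (numeral of the) Gödel code of $\sigma$. *)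

(* Defs.v *)
From Stdlib Require Import Arith List Cantor.
Import ListNotations.

Set Implicit Arguments.
Unset Strict Implicit.

(** * Syntax *)

(** Variables are de Bruijn indices. *)
Inductive term : Type :=
| Var (n : nat)
| Zero
| One
| Add (s t : term)
| Mul (s t : term).

(** [form X] is the set of formulae of the language of arithmetic extended by
    one unary relation symbol for each element of [X]. *)
Inductive form (X : Type) : Type :=
| Bot
| Eq (s t : term)
| Lt (s t : term)
| Rel (r : X) (t : term)
| And (p q : form X)
| Or (p q : form X)
| Imp (p q : form X)
| All (p : form X)
| Ex (p : form X).

Arguments Bot {X}.
Arguments Eq {X} s t.
Arguments Lt {X} s t.

Definition Not X (p : form X) : form X := Imp p Bot.
Definition Iff X (p q : form X) : form X := And (Imp p q) (Imp q p).

Definition formLA : Type := form Empty_set.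

Inductive symP : Type := P.
Definition formLAP : Type := form symP.

Fixpoint embed X (p : formLA) : form X :=
  match p with
  | Bot => Bot
  | Eq s t => Eq s t
  | Lt s t => Lt s t
  | Rel r _ => match r with end
  | And p q => And (embed X p) (embed X q)
  | Or p q => Or (embed X p) (embed X q)
  | Imp p q => Imp (embed X p) (embed X q)
  | All p => All (embed X p)
  | Ex p => Ex (embed X p)
  end.

(** ** Substitution *)

Fixpoint tsubst (f : nat -> term) (t : term) : term :=
  match t with
  | Var n => f n
  | Zero => Zero
  | One => One
  | Add s t => Add (tsubst f s) (tsubst f t)
  | Mul s t => Mul (tsubst f s) (tsubst f t)
  end.

Definition tshift : term -> term := tsubst (fun n => Var (S n)).

Definition up (f : nat -> term) (n : nat) : term :=
  match n with
  | 0 => Var 0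
  | S n => tshift (f n)
  end.

Fixpoint subst X (f : nat -> term) (p : form X) : form X :=
  match p with
  | Bot => Bot
  | Eq s t => Eq (tsubst f s) (tsubst f t)
  | Lt s t => Lt (tsubst f s) (tsubst f t)
  | Rel r t => Rel r (tsubst f t)
  | And p q => And (subst f p) (subst f q)
  | Or p q => Or (subst f p) (subst f q)
  | Imp p q => Imp (subst f p) (subst f q)
  | All p => All (subst (up f) p)
  | Ex p => Ex (subst (up f) p)
  end.

Definition shift X : form X -> form X := subst (fun n => Var (S n)).

(** [inst p t] removes the outermost variable of [p] by setting it to [t]; the
    remaining variables are lowered accordingly. *)
Definition inst X (p : form X) (t : term) : form X :=
  subst (fun n => match n with 0 => t | S n => Var n end) p.

(** ** Free variables *)

Fixpoint tbounded (n : nat) (t : term) : Prop :=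
  match t with
  | Var k => k < n
  | Zero | One => True
  | Add s t | Mul s t => tbounded n s /\ tbounded n t
  end.

(** All free variables of [p] are among [Var 0, ..., Var (n - 1)]. *)
Fixpoint bounded X (n : nat) (p : form X) : Prop :=
  match p with
  | Bot => True
  | Eq s t | Lt s t => tbounded n s /\ tbounded n t
  | Rel _ t => tbounded n t
  | And p q | Or p q | Imp p q => bounded n p /\ bounded n q
  | All p | Ex p => bounded (S n) p
  end.

Definition sentence X (p : form X) : Prop := bounded 0 p.

(** ** Classes of formulae *)

(** In a bounded quantifier the bound [t] does not contain the quantified
    variable, hence the shift. *)
Definition BAll X (t : term) (p : form X) : form X :=
  All (Imp (Lt (Var 0) (tshift t)) p).
Definition BEx X (t : term) (p : form X) : form X :=
  Ex (And (Lt (Var 0) (tshift t)) p).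

Inductive Delta0 X : form X -> Prop :=
| Delta0_Bot : Delta0 Bot
| Delta0_Eq s t : Delta0 (Eq s t)
| Delta0_Lt s t : Delta0 (Lt s t)
| Delta0_Rel r t : Delta0 (Rel r t)
| Delta0_And p q : Delta0 p -> Delta0 q -> Delta0 (And p q)
| Delta0_Or p q : Delta0 p -> Delta0 q -> Delta0 (Or p q)
| Delta0_Imp p q : Delta0 p -> Delta0 q -> Delta0 (Imp p q)
| Delta0_BAll t p : Delta0 p -> Delta0 (BAll t p)
| Delta0_BEx t p : Delta0 p -> Delta0 (BEx t p).

Definition AllN X (n : nat) (p : form X) : form X := Nat.iter n (@All X) p.
Definition ExN X (n : nat) (p : form X) : form X := Nat.iter n (@Ex X) p.

Definition Sigma2 X (p : form X) : Prop :=
  exists (m n : nat) (d : form X), Delta0 d /\ p = ExN m (AllN n d).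

(** * Provability: classical natural deduction with equality *)

Inductive proves X : list (form X) -> form X -> Prop :=
| Ax G p : In p G -> proves G p
| BotC G p : proves (Not p :: G) Bot -> proves G p
| AndI G p q : proves G p -> proves G q -> proves G (And p q)
| AndE1 G p q : proves G (And p q) -> proves G p
| AndE2 G p q : proves G (And p q) -> proves G q
| OrI1 G p q : proves G p -> proves G (Or p q)
| OrI2 G p q : proves G q -> proves G (Or p q)
| OrE G p q r :
    proves G (Or p q) -> proves (p :: G) r -> proves (q :: G) r -> proves G r
| ImpI G p q : proves (p :: G) q -> proves G (Imp p q)
| ImpE G p q : proves G (Imp p q) -> proves G p -> proves G q
| AllI G p : proves (map (@shift X) G) p -> proves G (All p)
| AllE G p t : proves G (All p) -> proves G (inst p t)
| ExI G p t : proves G (inst p t) -> proves G (Ex p)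
| ExE G p q :
    proves G (Ex p) -> proves (p :: map (@shift X) G) (shift q) -> proves G q
| EqI G t : proves G (Eq t t)
| EqE G p s t : proves G (Eq s t) -> proves G (inst p s) -> proves G (inst p t).

Definition theory (X : Type) : Type := form X -> Prop.

Definition Tproves X (T : theory X) (p : form X) : Prop :=
  exists G : list (form X), (forall q, In q G -> T q) /\ proves G p.

Definition consistent X (T : theory X) : Prop := ~ Tproves T Bot.

(** * The standard model and its expansions *)

Fixpoint teval (v : nat -> nat) (t : term) : nat :=
  match t with
  | Var n => v n
  | Zero => 0
  | One => 1
  | Add s t => teval v s + teval v t
  | Mul s t => teval v s * teval v t
  end.

Definition vcons (a : nat) (v : nat -> nat) (n : nat) : nat :=
  match n with 0 => a | S n => v n end.

Fixpoint sat X (I : X -> nat -> Prop) (v : nat -> nat) (p : form X) : Prop :=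
  match p with
  | Bot => False
  | Eq s t => teval v s = teval v t
  | Lt s t => teval v s < teval v t
  | Rel r t => I r (teval v t)
  | And p q => sat I v p /\ sat I v q
  | Or p q => sat I v p \/ sat I v q
  | Imp p q => sat I v p -> sat I v q
  | All p => forall a, sat I (vcons a v) p
  | Ex p => exists a, sat I (vcons a v) p
  end.

Definition models X (I : X -> nat -> Prop) (p : form X) : Prop :=
  forall v, sat I v p.

Definition has_standard_model X (p : form X) : Prop :=
  exists I : X -> nat -> Prop, models I p.

Definition noRel (r : Empty_set) (_ : nat) : Prop := match r with end.

Definition ThN (p : formLA) : Prop := sentence p /\ models noRel p.

(** Th(N), viewed in the larger language, together with [a]. *)
Definition ThN_plus X (a : form X) : theory X :=
  fun q => (exists p : formLA, ThN p /\ q = embed X p) \/ q = a.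

(** * Elementary arithmetic *)

Definition Le (s t : term) : formLA := Or (Lt s t) (Eq s t).

(** The discretely ordered semiring axioms of Kaye, "Models of Peano
    Arithmetic", Section 2.1. *)
Inductive PAminus : formLA -> Prop :=
| PA_addA : PAminus (AllN 3
    (Eq (Add (Add (Var 2) (Var 1)) (Var 0)) (Add (Var 2) (Add (Var 1) (Var 0)))))
| PA_addC : PAminus (AllN 2 (Eq (Add (Var 1) (Var 0)) (Add (Var 0) (Var 1))))
| PA_mulA : PAminus (AllN 3
    (Eq (Mul (Mul (Var 2) (Var 1)) (Var 0)) (Mul (Var 2) (Mul (Var 1) (Var 0)))))
| PA_mulC : PAminus (AllN 2 (Eq (Mul (Var 1) (Var 0)) (Mul (Var 0) (Var 1))))
| PA_mulDr : PAminus (AllN 3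
    (Eq (Mul (Var 2) (Add (Var 1) (Var 0)))
        (Add (Mul (Var 2) (Var 1)) (Mul (Var 2) (Var 0)))))
| PA_add0 : PAminus (All (Eq (Add (Var 0) Zero) (Var 0)))
| PA_mul0 : PAminus (All (Eq (Mul (Var 0) Zero) Zero))
| PA_mul1 : PAminus (All (Eq (Mul (Var 0) One) (Var 0)))
| PA_lt_trans : PAminus (AllN 3
    (Imp (And (Lt (Var 2) (Var 1)) (Lt (Var 1) (Var 0))) (Lt (Var 2) (Var 0))))
| PA_lt_irrefl : PAminus (All (Not (Lt (Var 0) (Var 0))))
| PA_lt_total : PAminus (AllN 2
    (Or (Lt (Var 1) (Var 0)) (Or (Eq (Var 1) (Var 0)) (Lt (Var 0) (Var 1)))))
| PA_lt_add : PAminus (AllN 3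
    (Imp (Lt (Var 2) (Var 1)) (Lt (Add (Var 2) (Var 0)) (Add (Var 1) (Var 0)))))
| PA_lt_mul : PAminus (AllN 3
    (Imp (And (Lt Zero (Var 0)) (Lt (Var 2) (Var 1)))
         (Lt (Mul (Var 2) (Var 0)) (Mul (Var 1) (Var 0)))))
| PA_sub : PAminus (AllN 2
    (Imp (Lt (Var 1) (Var 0)) (Ex (Eq (Add (Var 2) (Var 0)) (Var 1)))))
| PA_lt01 : PAminus (Lt Zero One)
| PA_discrete : PAminus (All (Imp (Lt Zero (Var 0)) (Le One (Var 0))))
| PA_nonneg : PAminus (All (Le Zero (Var 0))).

(** Induction on [Var 0]; the other free variables of [p] are parameters. *)
Definition induction_for (p : formLA) : formLA :=
  Imp (And (inst p Zero)
           (All (Imp p (subst (fun n => match n with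
                                        | 0 => Add (Var 0) One
                                        | S _ => Var n
                                        end) p))))
      (All p).

(** Goedel's beta function: [v] is the remainder of [c] modulo
    [1 + (i + 1) * d]. *)
Definition beta_eq (c d i v : term) : formLA :=
  let m := Add One (Mul (Add i One) d) in
  And (Lt v m)
      (BEx (Add c One) (Eq (tshift c) (Add (Mul (Var 0) (tshift m)) (tshift v)))).

(** The graph z = x ^ y: some [c], [d] code, through the beta function, a
    sequence that starts with 1, is multiplied by [x] at each of its first [y]
    steps, and takes the value [z] at [y].  In the matrix, the variables are
    1 = [c] and 0 = [d]. *)
Definition exp_graph (x y z : term) : formLA :=
  let s2 t := tshift (tshift t) in
  let s3 t := tshift (s2 t) in
  let s4 t := tshift (s3 t) in
  Ex (Ex (And (beta_eq (Var 1) (Var 0) Zero One)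
         (And (BAll (s2 y) (* 2 = c, 1 = d, 0 = i *)
                (BEx (Add (Var 2) One) (* 3 = c, 2 = d, 1 = i, 0 = u *)
                  (And (beta_eq (Var 3) (Var 2) (Var 1) (Var 0))
                       (beta_eq (Var 3) (Var 2) (Add (Var 1) One)
                                (Mul (s4 x) (Var 0))))))
              (beta_eq (Var 1) (Var 0) (s2 y) (s2 z))))).

(** The induction axioms are the universal closures of the induction
    formulae. *)
Inductive EA : formLA -> Prop :=
| EA_PAminus p : PAminus p -> EA p
| EA_induction n p :
    Delta0 p -> sentence (AllN n (induction_for p)) ->
    EA (AllN n (induction_for p))
| EA_exp : EA (AllN 2 (Ex (exp_graph (Var 2) (Var 1) (Var 0)))).

(** * Theories of truth *)

Definition cpair (a b : nat) : nat := Cantor.to_nat (a, b).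

Fixpoint tcode (t : term) : nat :=
  match t with
  | Var n => cpair 0 n
  | Zero => cpair 1 0
  | One => cpair 2 0
  | Add s t => cpair 3 (cpair (tcode s) (tcode t))
  | Mul s t => cpair 4 (cpair (tcode s) (tcode t))
  end.

Fixpoint code (p : formLA) : nat :=
  match p with
  | Bot => cpair 0 0
  | Eq s t => cpair 1 (cpair (tcode s) (tcode t))
  | Lt s t => cpair 2 (cpair (tcode s) (tcode t))
  | Rel r _ => match r with end
  | And p q => cpair 3 (cpair (code p) (code q))
  | Or p q => cpair 4 (cpair (code p) (code q))
  | Imp p q => cpair 5 (cpair (code p) (code q))
  | All p => cpair 6 (code p)
  | Ex p => cpair 7 (code p)
  end.

Fixpoint numeral (n : nat) : term :=
  match n with
  | 0 => Zero
  | S n => Add (numeral n) One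
  end.

Definition contains_EA X (T : theory X) : Prop :=
  forall p, EA p -> Tproves T (embed X p).

Definition theory_of_truth X (T : theory X) : Prop :=
  consistent T /\ contains_EA T /\
  exists Theta : form X, bounded 1 Theta /\
    forall s : formLA, sentence s ->
      Tproves T (Iff (inst Theta (numeral (code s))) (embed X s)).

(* Main.v *)
From Stdlib Require Import Arith List Lia Classical FunctionalExtensionality.
From Stdlib Require Cantor.
Require Import Defs.
Import ListNotations.

Set Implicit Arguments.
Unset Strict Implicit.

(** Fix a witness tuple [a] for the existential block of [alpha] in the given
    standard model.  The sets [A] that satisfy the remaining universal formula
    at [a] form a nonempty Pi^0_1 class in Cantor space, because the truth value
    of a [Delta0] instance depends on finitely many values of [A] only.  The
    leftmost path of the corresponding tree is an arithmetical member of this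
    class (Kreisel's basis theorem).  So [alpha] has a standard model in which
    [P] is arithmetical, and a truth predicate would yield, by soundness, an
    arithmetical definition of arithmetical truth, against Tarski. *)

(** * Satisfaction, substitution and soundness *)

Lemma teval_tsubst v f t :
  teval v (tsubst f t) = teval (fun i => teval v (f i)) t.
Proof. induction t; simpl; congruence. Qed.

Lemma teval_numeral v n : teval v (numeral n) = n.
Proof. induction n; simpl; lia. Qed.

Lemma teval_up a v f :
  (fun i => teval (vcons a v) (up f i)) = vcons a (fun i => teval v (f i)).
Proof.
  apply functional_extensionality; intros [|i]; simpl; auto.
  unfold tshift; now rewrite teval_tsubst.
Qed.

Lemma sat_subst X (I : X -> nat -> Prop) (p : form X) : forall v f,
  sat I v (subst f p) <-> sat I (fun i => teval v (f i)) p.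
Proof.
  induction p; intros v f; simpl; rewrite ?teval_tsubst; try reflexivity.
  - now rewrite IHp1, IHp2.
  - now rewrite IHp1, IHp2.
  - now rewrite IHp1, IHp2.
  - split; intros H a; specialize (H a); revert H; now rewrite IHp, teval_up.
  - split; intros [a H]; exists a; revert H; now rewrite IHp, teval_up.
Qed.

Lemma sat_shift X (I : X -> nat -> Prop) v a (p : form X) :
  sat I (vcons a v) (shift p) <-> sat I v p.
Proof. apply sat_subst. Qed.

Lemma sat_inst X (I : X -> nat -> Prop) v t (p : form X) :
  sat I v (inst p t) <-> sat I (vcons (teval v t) v) p.
Proof.
  unfold inst; rewrite sat_subst.
  replace (fun i => teval v match i with 0 => t | S n => Var n end)
    with (vcons (teval v t) v); [reflexivity|].
  apply functional_extensionality; now intros [|i].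
Qed.

Lemma sat_embed X (I : X -> nat -> Prop) (p : formLA) : forall v,
  sat I v (embed X p) <-> sat noRel v p.
Proof.
  induction p; intros v; simpl; try reflexivity.
  - destruct r.
  - now rewrite IHp1, IHp2.
  - now rewrite IHp1, IHp2.
  - now rewrite IHp1, IHp2.
  - split; intros H a; apply IHp, H.
  - split; intros [a H]; exists a; apply IHp, H.
Qed.

Lemma soundness X (G : list (form X)) (p : form X) :
  proves G p -> forall (I : X -> nat -> Prop) v,
  (forall q, In q G -> sat I v q) -> sat I v p.
Proof.
  assert (ext : forall (I : X -> nat -> Prop) v (q : form X) L,
    sat I v q -> (forall r, In r L -> sat I v r) ->
    forall r, In r (q :: L) -> sat I v r) by (intros ? ? ? ? ? ? ? [<-|]; auto).
  assert (exts : forall (I : X -> nat -> Prop) v a L,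
    (forall r, In r L -> sat I v r) ->
    forall r, In r (map (@shift X) L) -> sat I (vcons a v) r).
  { intros I v a L HL r [q [<- Hq]]%in_map_iff; apply sat_shift; auto. }
  induction 1; intros I v HG; simpl in *.
  - auto.
  - apply NNPP; intros np; exact (IHproves I v (ext I v (Not p) G np HG)).
  - split; [apply IHproves1 | apply IHproves2]; auto.
  - now apply (IHproves I v).
  - now apply (IHproves I v).
  - left; apply IHproves; auto.
  - right; apply IHproves; auto.
  - destruct (IHproves1 I v HG); [apply IHproves2 | apply IHproves3]; apply ext; auto.
  - intros Hp; apply IHproves; apply ext; auto.
  - exact (IHproves1 I v HG (IHproves2 I v HG)).
  - intros a; apply IHproves, exts, HG.
  - apply sat_inst, (IHproves I v HG).
  - eexists; apply sat_inst, (IHproves I v HG).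
  - destruct (IHproves1 I v HG) as [a Ha].
    apply (sat_shift I v a), IHproves2, ext; [exact Ha | now apply exts].
  - reflexivity.
  - apply sat_inst; rewrite <- (IHproves1 I v HG : teval v s = teval v t).
    apply sat_inst, (IHproves2 I v HG).
Qed.

Lemma tbounded_tsubst n f t :
  (forall i, tbounded n (f i)) -> tbounded n (tsubst f t).
Proof. intros Hf; induction t; simpl; auto. Qed.

Lemma tbounded_tshift n t : tbounded n t -> tbounded (S n) (tshift t).
Proof.
  induction t; simpl; auto; [lia | intros [] .. ]; split; auto.
Qed.

Lemma bounded_subst X (p : form X) : forall n f,
  (forall i, tbounded n (f i)) -> bounded n (subst f p).
Proof.
  assert (Hup : forall n f, (forall i, tbounded n (f i)) ->
                forall i, tbounded (S n) (up f i)).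
  { intros n f Hf [|i]; simpl; [lia | now apply tbounded_tshift]. }
  induction p; intros n f Hf; simpl; auto using tbounded_tsubst.
Qed.

Lemma tbounded_numeral n k : tbounded n (numeral k).
Proof. induction k; simpl; auto. Qed.

(** * Arithmetical relations *)

(** A relation is a predicate on whole assignments: its arguments are the coordinates of [v], and a
    quantifier shifts them as de Bruijn indices. *)
Definition definable (R : (nat -> nat) -> Prop) : Prop :=
  exists p : formLA, forall v, sat noRel v p <-> R v.

(** The graph of [f], with the value in variable 0, so that composition is a quantification over
    that variable. *)
Definition definableF (f : (nat -> nat) -> nat) : Prop :=
  definable (fun v => v 0 = f (fun i => v (S i))).

Lemma definable_ext (R S : (nat -> nat) -> Prop) :
  (forall v, S v <-> R v) -> definable R -> definable S.
Proof. intros E [p Hp]; exists p; intros v; now rewrite Hp, E. Qed.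

Lemma definable_and R S : definable R -> definable S -> definable (fun v => R v /\ S v).
Proof. intros [p Hp] [q Hq]; exists (And p q); intros v; simpl; now rewrite Hp, Hq. Qed.

Lemma definable_or R S : definable R -> definable S -> definable (fun v => R v \/ S v).
Proof. intros [p Hp] [q Hq]; exists (Or p q); intros v; simpl; now rewrite Hp, Hq. Qed.

Lemma definable_imp (R S : (nat -> nat) -> Prop) :
  definable R -> definable S -> definable (fun v => R v -> S v).
Proof. intros [p Hp] [q Hq]; exists (Imp p q); intros v; simpl; now rewrite Hp, Hq. Qed.

Lemma definable_False : definable (fun _ => False).
Proof. now exists Bot. Qed.

Lemma definable_not R : definable R -> definable (fun v => ~ R v).
Proof. intros H; exact (definable_imp H definable_False). Qed.

Lemma definable_iff R S : definable R -> definable S -> definable (fun v => R v <-> S v).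
Proof. intros HR HS; apply definable_and; now apply definable_imp. Qed.

Lemma definable_all (Q : nat -> (nat -> nat) -> Prop) :
  definable (fun v => Q (v 0) (fun i => v (S i))) -> definable (fun v => forall a, Q a v).
Proof.
  intros [p Hp]; exists (All p); intros v.
  split; intros H a; exact (proj1 (Hp (vcons a v)) (H a)) || exact (proj2 (Hp (vcons a v)) (H a)).
Qed.

Lemma definable_ex (Q : nat -> (nat -> nat) -> Prop) :
  definable (fun v => Q (v 0) (fun i => v (S i))) -> definable (fun v => exists a, Q a v).
Proof.
  intros [p Hp]; exists (Ex p); intros v.
  split; intros [a H]; exists a;
    exact (proj1 (Hp (vcons a v)) H) || exact (proj2 (Hp (vcons a v)) H).
Qed.

Lemma definable_subst R (f : nat -> term) :
  definable R -> definable (fun v => R (fun i => teval v (f i))).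
Proof. intros [p Hp]; exists (subst f p); intros v; now rewrite sat_subst. Qed.

Lemma definable_app1 (R : nat -> Prop) f :
  definable (fun v => R (v 0)) -> definableF f -> definable (fun v => R (f v)).
Proof.
  intros HR Hf; apply definable_ext with (R := fun v => exists a, a = f v /\ R a).
  { intros v; split; [eauto | now intros (a & -> & H)]. }
  apply definable_ex, definable_and; assumption.
Qed.

(** Weakening under a quantifier: variable 0 keeps the value, and the arguments skip the new
    variable 1. *)
Lemma definableF_tail f : definableF f -> definableF (fun v => f (fun i => v (S i))).
Proof.
  exact (definable_subst (fun i => match i with 0 => Var 0 | S i => Var (S (S i)) end)).
Qed.

(** The last argument is quantified first, so that the arguments end up in variables 0 and 1 in the
    order of [R]. *)
Lemma definable_app2 (R : nat -> nat -> Prop) f g :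
  definable (fun v => R (v 0) (v 1)) ->
  definableF f -> definableF g -> definable (fun v => R (f v) (g v)).
Proof.
  intros HR Hf Hg.
  apply definable_ext with (R := fun v => exists b, b = g v /\ exists a, a = f v /\ R a b).
  { intros v; split; [eauto 6 | now intros (b & -> & a & -> & H)]. }
  apply definable_ex, definable_and; [exact Hg|].
  apply definable_ex, definable_and; [exact (definableF_tail Hf) | exact HR].
Qed.

Lemma definable_app3 (R : nat -> nat -> nat -> Prop) f g h :
  definable (fun v => R (v 0) (v 1) (v 2)) ->
  definableF f -> definableF g -> definableF h ->
  definable (fun v => R (f v) (g v) (h v)).
Proof.
  intros HR Hf Hg Hh.
  apply definable_ext with (R := fun v =>
    exists c, c = h v /\ exists b, b = g v /\ exists a, a = f v /\ R a b c).
  { intros v; split; [eauto 8 | now intros (c & -> & b & -> & a & -> & H)]. }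
  apply definable_ex, definable_and; [exact Hh|].
  apply definable_ex, definable_and; [exact (definableF_tail Hg)|].
  apply definable_ex, definable_and; [| exact HR].
  exact (definableF_tail (definableF_tail Hf)).
Qed.

Lemma definableF_var n : definableF (fun v => v n).
Proof. now exists (Eq (Var 0) (Var (S n))). Qed.

Lemma definableF_const n : definableF (fun _ => n).
Proof. exists (Eq (Var 0) (numeral n)); intros v; simpl; now rewrite teval_numeral. Qed.

Lemma definable_eq f g : definableF f -> definableF g -> definable (fun v => f v = g v).
Proof. apply definable_app2 with (R := fun a b => a = b); now exists (Eq (Var 0) (Var 1)). Qed.

Lemma definable_lt f g : definableF f -> definableF g -> definable (fun v => f v < g v).
Proof. apply definable_app2 with (R := fun a b => a < b); now exists (Lt (Var 0) (Var 1)). Qed.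

Lemma definableF_app2 (op : nat -> nat -> nat) f g :
  definable (fun v => v 0 = op (v 1) (v 2)) ->
  definableF f -> definableF g -> definableF (fun v => op (f v) (g v)).
Proof.
  intros Hop Hf Hg; apply (definable_app3 (R := fun a b c => a = op b c)); auto.
  - apply definableF_var.
  - now apply definableF_tail in Hf.
  - now apply definableF_tail in Hg.
Qed.

Lemma definableF_add f g : definableF f -> definableF g -> definableF (fun v => f v + g v).
Proof. apply definableF_app2; now exists (Eq (Var 0) (Add (Var 1) (Var 2))). Qed.

Lemma definableF_mul f g : definableF f -> definableF g -> definableF (fun v => f v * g v).
Proof. apply definableF_app2; now exists (Eq (Var 0) (Mul (Var 1) (Var 2))). Qed.

(** Works through connectives, quantifiers, sums and products; goals about other functions or
    relations are left to the caller. *)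
Ltac definable :=
  cbv beta; lazymatch goal with
  | |- definable (fun v => _ /\ _) => apply definable_and; definable
  | |- definable (fun v => _ \/ _) => apply definable_or; definable
  | |- definable (fun v => ~ _) => apply definable_not; definable
  | |- definable (fun v => _ <-> _) => apply definable_iff; definable
  | |- definable (fun v => _ = _) => apply definable_eq; definable
  | |- definable (fun v => _ < _) => apply definable_lt; definable
  | |- definable (fun v => exists a, _) => apply definable_ex; definable
  | |- definable (fun v => forall a : nat, _) => apply definable_all; definable
  | |- definable (fun v => _ -> _) => apply definable_imp; definable
  | |- definableF (fun v => _ + _) => apply definableF_add; definable
  | |- definableF (fun v => _ * _) => apply definableF_mul; definable
  | |- definableF _ => first [apply definableF_var | apply definableF_const | idtac]
  | |- _ => idtac
  end.

(** Doubling clears the division in Cantor's [b + (a + b) * (a + b + 1) / 2] and leaves a polynomial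
    equation. *)
Lemma cpair_spec z a b : z = cpair a b <-> z + z = b + b + (a + b) * (a + b + 1).
Proof.
  unfold cpair; pose proof (Cantor.to_nat_spec a b); split; [intros ->|]; nia.
Qed.

Lemma definableF_cpair f g :
  definableF f -> definableF g -> definableF (fun v => cpair (f v) (g v)).
Proof.
  apply definableF_app2.
  eapply definable_ext; [intros v; apply cpair_spec|]; definable.
Qed.

Lemma cpair_inj a b c d : cpair a b = cpair c d -> a = c /\ b = d.
Proof.
  intros H; apply (f_equal Cantor.of_nat) in H; unfold cpair in H.
  rewrite !Cantor.cancel_of_to in H; now injection H.
Qed.

(** The induction is on a fixed formula, outside arithmetic, so there is no conflict with Tarski.
    The symbols are read as the section of [M] at a parameter [s], for instance a set code; [s] and
    [w] depend on [v] so that the induction passes quantifiers. *)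
Lemma definable_sat X (M : nat -> nat -> Prop) (p : form X) :
  definable (fun v => M (v 0) (v 1)) ->
  forall s w, definableF s -> (forall i, definableF (fun v => w v i)) ->
  definable (fun v => sat (fun _ x => M x (s v)) (w v) p).
Proof.
  intros HM.
  assert (Ht : forall w, (forall i, definableF (fun v => w v i)) ->
               forall t, definableF (fun v => teval (w v) t)).
  { intros w Hw t; induction t; simpl.
    - apply Hw.
    - apply definableF_const.
    - apply definableF_const.
    - now apply definableF_add.
    - now apply definableF_mul. }
  assert (Hc : forall w, (forall i, definableF (fun v => w v i)) ->
    forall i, definableF (fun v => vcons (v 0) (w (fun i => v (S i))) i)).
  { intros w Hw [|i]; simpl; [apply definableF_var | exact (definableF_tail (Hw i))]. }
  induction p; intros s' w Hs Hw; simpl.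
  - apply definable_False.
  - apply definable_eq; auto.
  - apply definable_lt; auto.
  - apply definable_app2; auto.
  - apply definable_and; auto.
  - apply definable_or; auto.
  - apply definable_imp; auto.
  - apply definable_all, (IHp (fun v => s' (fun i => v (S i)))); [now apply definableF_tail | now apply Hc].
  - apply definable_ex, (IHp (fun v => s' (fun i => v (S i)))); [now apply definableF_tail | now apply Hc].
Qed.

(** * Coding finite sets *)

(** The moduli of Goedel's beta function. *)
Definition modulus (d x : nat) : nat := 1 + (x + 1) * d.

Definition mem (x s : nat) : Prop :=
  exists c d, s = cpair c d /\ exists q, c = q * modulus d x.

Lemma definable_mem f g : definableF f -> definableF g -> definable (fun v => mem (f v) (g v)).
Proof.
  apply definable_app2; unfold mem, modulus; definable.
  apply definableF_cpair; definable.
Qed.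

Lemma mem_cpair x c d : mem x (cpair c d) <-> Nat.divide (modulus d x) c.
Proof.
  split.
  - intros (c' & d' & E & H); apply cpair_inj in E as [-> ->]; exact H.
  - intros H; now exists c, d.
Qed.

Lemma divide_fact n k : 1 <= k <= n -> Nat.divide k (fact n).
Proof.
  induction n as [|n IH]; intros H; [lia|].
  change (fact (S n)) with (S n * fact n).
  destruct (Nat.eq_dec k (S n)) as [->|Hk].
  - apply Nat.divide_factor_l.
  - apply Nat.divide_mul_r, IH; lia.
Qed.

(* A common divisor of both moduli divides [y - x], hence [fact n], hence 1. *)
Lemma modulus_coprime_lt n x y :
  x < y -> y < n -> Nat.gcd (modulus (fact n) x) (modulus (fact n) y) = 1.
Proof.
  intros Hxy Hy; set (d := fact n); set (g := Nat.gcd _ _).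
  assert (Hgx : Nat.divide g (modulus d x)) by apply Nat.gcd_divide_l.
  assert (Hgy : Nat.divide g (modulus d y)) by apply Nat.gcd_divide_r.
  assert (Hg : Nat.divide g (y - x)).
  (* The multiples of [d] in the two products cancel. *)
  { replace (y - x) with ((y + 1) * modulus d x - (x + 1) * modulus d y)
      by (unfold modulus; nia).
    apply Nat.divide_sub_r; now apply Nat.divide_mul_r. }
  assert (Hd : Nat.divide g d)
    by (apply (Nat.divide_trans _ _ _ Hg), divide_fact; lia).
  apply Nat.divide_1_r.
  replace 1 with (modulus d x - (x + 1) * d) by (unfold modulus; lia).
  apply Nat.divide_sub_r; [exact Hgx | now apply Nat.divide_mul_r].
Qed.

Lemma modulus_coprime n x y :
  x <> y -> x < n -> y < n -> Nat.gcd (modulus (fact n) x) (modulus (fact n) y) = 1.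
Proof.
  intros H Hx Hy; destruct (Nat.lt_total x y) as [L|[E|L]]; [|easy|rewrite Nat.gcd_comm];
    now apply modulus_coprime_lt.
Qed.

(** Take [d = fact n] and let [c] be the product of the moduli of the members below [n]; by
    coprimality no other modulus below [n] divides [c]. *)
Lemma finite_set_code (A : nat -> Prop) n : exists s, forall x, x < n -> (mem x s <-> A x).
Proof.
  set (d := fact n).
  assert (H : forall k, k <= n -> exists c, forall x, x < n ->
            (Nat.divide (modulus d x) c <-> x < k /\ A x)).
  { induction k as [|k IH]; intros Hk.
    (* The empty product: every modulus exceeds 1 because [fact n] is positive. *)
    - exists 1; intros x Hx; split; [|lia].
      intros E%Nat.divide_1_r; pose proof (lt_O_fact n); unfold modulus, d in E; nia.
    - destruct IH as [c Hc]; [lia|].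
      destruct (classic (A k)) as [HA|HA].
      + exists (modulus d k * c); intros x Hx; destruct (Nat.eq_dec x k) as [->|Hxk].
        * split; [intros _; split; [lia | assumption] | intros _; apply Nat.divide_factor_l].
        * split.
          -- intros E; apply Nat.gauss in E; [|apply modulus_coprime; lia].
             apply Hc in E; intuition lia.
          -- intros [L HAx]; apply Nat.divide_mul_r, Hc; [assumption|].
             split; [lia | assumption].
      + exists c; intros x Hx; rewrite Hc by assumption.
        destruct (Nat.eq_dec x k) as [->|]; intuition lia. }
  destruct (H n (le_n n)) as [c Hc]; exists (cpair c d).
  intros x Hx; rewrite mem_cpair, Hc by assumption; tauto.
Qed.

(** * Undefinability of truth *)

(** The code of [Add t One], where [u] is the code of [t]. *)
Definition numeral_step (u : nat) : nat := cpair 3 (cpair u (cpair 2 0)).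

(* The recursion is unravelled downwards along a finite set of pairs bounded by
   [b]; membership above [b] is uncontrolled. *)
Lemma tcode_numeral_spec n y :
  y = tcode (numeral n) <->
  exists s b, (cpair n y < b /\ mem (cpair n y) s) /\
    forall i u, cpair i u < b -> mem (cpair i u) s ->
      (i = 0 /\ u = cpair 1 0) \/
      exists j w, (i = j + 1 /\ u = numeral_step w) /\
                  cpair j w < b /\ mem (cpair j w) s.
Proof.
  split.
  - intros ->.
    assert (Hb : exists b, forall i, i <= n -> cpair i (tcode (numeral i)) < b).
    { clear; induction n as [|n [b Hb]].
      - exists (S (cpair 0 (tcode (numeral 0)))); intros i Hi.
        replace i with 0 by lia; apply Nat.lt_succ_diag_r.
      - exists (S (b + cpair (S n) (tcode (numeral (S n))))); intros i Hi.
        destruct (Nat.eq_dec i (S n)) as [->|]; [lia|].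
        specialize (Hb i); lia. }
    destruct Hb as [b Hb].
    (* The set is the history of the recursion up to [n], and [b] exceeds all its pairs. *)
    destruct (finite_set_code (fun z => exists i, i <= n /\ z = cpair i (tcode (numeral i))) b)
      as [s Hs].
    exists s, b; split; [split|].
    + now apply Hb.
    + apply Hs; [now apply Hb | eauto].
    + intros i u Hiu Hm; apply Hs in Hm; [|assumption].
      destruct Hm as (i' & Hi & E); apply cpair_inj in E as [<- ->].
      destruct i as [|j]; [now left|right].
      exists j, (tcode (numeral j)).
      assert (cpair j (tcode (numeral j)) < b) by (apply Hb; lia).
      repeat split; [lia | assumption |].
      apply Hs; [assumption|]; exists j; split; [lia | reflexivity].
  - intros (s & b & [Hb Hm] & H).
    (* Each pair of the set below [b] has its predecessor there too, so the descent from [n] reaches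
       0. *)
    revert y Hb Hm; induction n as [|n IH]; intros y Hb Hm;
      destruct (H _ _ Hb Hm) as [[E ->]|(j & w & [E ->] & Hb' & Hm')]; try lia.
    + reflexivity.
    + replace j with n in * by lia; now rewrite (IH _ Hb' Hm').
Qed.

Lemma definableF_tcode_numeral : definableF (fun v => tcode (numeral (v 0))).
Proof.
  eapply definable_ext; [intros v; apply tcode_numeral_spec|].
  unfold numeral_step; definable; try apply definable_mem; definable;
    repeat (apply definableF_cpair; definable).
Qed.

(** If [x] is the code of [q], this is the code of [Ex (And (Eq (Var 0) (numeral x)) q)], which says
    [q] of [x]. This diagonal avoids arithmetizing substitution. *)
Definition diag_code (x : nat) : nat :=
  cpair 7 (cpair 3 (cpair (cpair 1 (cpair (cpair 0 0) (tcode (numeral x)))) x)).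

(** Tarski's theorem: the diagonal of the formula saying that the diagonal of [x] is not in [Tr]
    asserts its own untruth. *)
Theorem truth_undefinable (Tr : nat -> Prop) :
  definable (fun v => Tr (v 0)) ->
  ~ (forall s : formLA, sentence s -> (Tr (code s) <-> models noRel s)).
Proof.
  intros HTr Htruth.
  assert (Hdiag : definable (fun v => ~ Tr (diag_code (v 0)))).
  { apply definable_not, definable_app1; [exact HTr|].
    unfold diag_code; repeat (apply definableF_cpair; definable).
    exact definableF_tcode_numeral. }
  destruct Hdiag as [p Hp].
  (* Replacing the variables other than [Var 0] closes the formula up to [Var 0]. *)
  set (q := subst (fun i => match i with 0 => Var 0 | S _ => Zero end) p).
  assert (Hq : forall v, sat noRel v q <-> ~ Tr (diag_code (v 0)))
    by (intros v; unfold q; now rewrite sat_subst, Hp).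
  set (s := Ex (And (Eq (Var 0) (numeral (code q))) q)).
  assert (Hs : sentence s).
  { repeat split; simpl; [lia | apply tbounded_numeral |].
    apply bounded_subst; intros [|i]; simpl; auto. }
  assert (Hsat : models noRel s <-> ~ Tr (code s)).
  (* The two codes agree by computation; this is the fixed point. *)
  { change (code s) with (diag_code (code q)); unfold models, s; simpl.
    split.
    - intros H; destruct (H (fun _ => 0)) as (a & E & Ha).
      rewrite teval_numeral in E; simpl in E; subst a; now apply Hq in Ha.
    - intros H v; exists (code q); rewrite teval_numeral; split; [reflexivity|].
      now apply Hq. }
  specialize (Htruth s Hs); tauto.
Qed.

(** * An arithmetical member of a nonempty Pi^0_1 class *)

Definition agree (n : nat) (A B : nat -> Prop) : Prop := forall x, x < n -> (A x <-> B x).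

(** These are the clopen subsets of Cantor space. *)
Definition finitary (Q : (nat -> Prop) -> Prop) : Prop :=
  exists n, forall A B, agree n A B -> (Q A <-> Q B).

Lemma agree_le m n A B : m <= n -> agree n A B -> agree m A B.
Proof. intros L H x Hx; apply H; lia. Qed.

Lemma agree_sym n A B : agree n A B -> agree n B A.
Proof. intros H x Hx; symmetry; now apply H. Qed.

Section LeftmostPath.

(* [Phi m A] says that [A] passes the first [m] tests of the class. *)
Variable Phi : nat -> (nat -> Prop) -> Prop.
Hypothesis Phi_finitary : forall m, finitary (Phi m).
Hypothesis Phi_antitone : forall m n A, m <= n -> Phi n A -> Phi m A.
Hypothesis Phi_definable : definable (fun v => Phi (v 0) (fun x => mem x (v 1))).
Hypothesis Phi_nonempty : exists A, forall m, Phi m A.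

Let extendible (n : nat) (A : nat -> Prop) : Prop :=
  forall m, exists t, agree n (fun x => mem x t) A /\ Phi m (fun x => mem x t).

(** By compactness this says that the first [n] values of [s], followed by false, begin a member of
    the class; quantifying over codes instead of sets keeps it arithmetical. *)
Let left_extendible (n s : nat) : Prop :=
  forall m, exists t, (forall x, x < n -> (mem x t <-> mem x s)) /\
                      ~ mem n t /\ Phi m (fun x => mem x t).

(** The path turns right, to true, only where the left branch is not extendible. *)
Let leftmost (n s : nat) : Prop :=
  forall i, i < n -> (mem i s <-> ~ left_extendible i s).

Let path (x : nat) : Prop := exists s, leftmost (x + 1) s /\ mem x s.

Lemma left_extendible_agree n s s' :
  agree n (fun x => mem x s) (fun x => mem x s') -> left_extendible n s -> left_extendible n s'.
Proof.
  intros H HL m; destruct (HL m) as (t & Ht & Hn & HP); exists t; split; auto.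
  intros x Hx; rewrite Ht by assumption; now apply H.
Qed.

Lemma leftmost_exists n : exists s, leftmost n s.
Proof.
  induction n as [|n [s Hs]]; [exists 0; intros i Hi; lia|].
  (* The values below [n] dictate the one at [n]. A fresh code is chosen, and the earlier conditions
     are carried over by agreement. *)
  destruct (finite_set_code (fun x => (x < n /\ mem x s) \/ (x = n /\ ~ left_extendible n s)) (S n))
    as [s' Hs'].
  assert (E : agree n (fun x => mem x s) (fun x => mem x s')).
  { intros x Hx; rewrite Hs' by lia; intuition lia. }
  assert (E' : agree n (fun x => mem x s') (fun x => mem x s)) by now apply agree_sym.
  exists s'; intros i Hi; destruct (Nat.eq_dec i n) as [->|Hin].
  - rewrite Hs' by lia; split.
    + intros [[L _]|[_ H]]; [lia|].
      intros HL; apply H, (left_extendible_agree E' HL).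
    + intros H; right; split; [reflexivity|].
      intros HL; apply H, (left_extendible_agree E HL).
  - assert (Ei : mem i s <-> mem i s') by (apply E; lia).
    rewrite <- Ei, (Hs i) by lia.
    assert (Hle : i <= n) by lia.
    pose proof (left_extendible_agree (agree_le Hle E)).
    pose proof (left_extendible_agree (agree_le Hle E')); tauto.
Qed.

(** Strong induction: each value is dictated by those before it. *)
Lemma leftmost_unique n s s' :
  leftmost n s -> leftmost n s' -> agree n (fun x => mem x s) (fun x => mem x s').
Proof.
  intros H H' x; induction x as [x IH] using lt_wf_ind; intros Hx.
  cbv beta; rewrite (H x Hx), (H' x Hx).
  assert (E : agree x (fun x => mem x s) (fun x => mem x s')) by (intros y Hy; apply IH; lia).
  assert (E' : agree x (fun x => mem x s') (fun x => mem x s)) by now apply agree_sym.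
  pose proof (left_extendible_agree E); pose proof (left_extendible_agree E'); tauto.
Qed.

Lemma leftmost_path n s : leftmost n s -> agree n (fun x => mem x s) path.
Proof.
  intros H x Hx.
  assert (Hx1 : leftmost (x + 1) s) by (intros i Hi; apply H; lia).
  split.
  - intros Hm; now exists s.
  - intros (s' & Hs' & Hm); apply (leftmost_unique Hx1 Hs'); [lia | assumption].
Qed.

(** An extendible node has an extendible child, and the path goes right only if the left child is
    not extendible. *)
Lemma path_extendible n : extendible n path.
Proof.
  induction n as [|n IH]; intros m.
  (* A member of the class may be replaced by a coded set that agrees with it as far as test [m]
     looks. *)
  - destruct Phi_nonempty as [A HA]; destruct (Phi_finitary m) as [k Hk].
    destruct (finite_set_code A k) as [t Ht]; exists t; split; [intros x Hx; lia|].
    now apply (Hk _ A Ht).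
  - destruct (leftmost_exists (S n)) as [s Hs].
    pose proof (leftmost_path Hs) as Hp.
    destruct (classic (left_extendible n s)) as [HL|HL].
    + destruct (HL m) as (t & Ht & Hn & HP); exists t; split; [|assumption].
      intros x Hx; rewrite <- (Hp x) by assumption.
      destruct (Nat.eq_dec x n) as [->|]; [|apply Ht; lia].
      specialize (Hs n); tauto.
    + apply not_all_ex_not in HL as Hno; destruct Hno as [m0 Hno].
      (* No left extension passes [m0] tests, so a [t] that passes them turns right at [n], as the
         path does. *)
      destruct (IH (Nat.max m m0)) as (t & Ht & HP); exists t; split.
      2: { apply (Phi_antitone (Nat.le_max_l m m0)), HP. }
      intros x Hx; destruct (Nat.eq_dec x n) as [->|]; [|apply Ht; lia].
      split; intros _.
      * apply Hp; [lia|]; apply Hs; [lia | exact HL].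
      * apply NNPP; intros Hn; apply Hno; exists t; split; [|split; [exact Hn|]].
        -- intros y Hy; rewrite (Ht y) by assumption; symmetry; apply Hp; lia.
        -- apply (Phi_antitone (Nat.le_max_r m m0)), HP.
Qed.

(** Each test looks at an initial segment of the path only, and that segment extends to a coded set
    passing the test. *)
Theorem arithmetical_member :
  exists A, definable (fun v => A (v 0)) /\ forall m, Phi m A.
Proof.
  exists path; split.
  - unfold path, leftmost, left_extendible; definable; try (apply definable_mem; definable).
    apply (definable_app2 (R := fun m t => Phi m (fun x => mem x t))); definable.
    exact Phi_definable.
  - intros m; destruct (Phi_finitary m) as [n Hn].
    destruct (path_extendible n m) as (t & Ht & HP); now apply (Hn _ _ Ht).
Qed.

End LeftmostPath.

(** * Sigma2 sentences *)

Lemma finitary_ext (Q R : (nat -> Prop) -> Prop) :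
  (forall A, R A <-> Q A) -> finitary Q -> finitary R.
Proof. intros E [n Hn]; exists n; intros A B HAB; rewrite !E; now apply Hn. Qed.

Lemma finitary_connective (op : Prop -> Prop -> Prop) Q R :
  (forall a b c d : Prop, (a <-> b) -> (c <-> d) -> (op a c <-> op b d)) ->
  finitary Q -> finitary R -> finitary (fun A => op (Q A) (R A)).
Proof.
  intros Hop [m Hm] [n Hn]; exists (Nat.max m n); intros A B HAB.
  apply Hop; [apply Hm | apply Hn]; revert HAB; apply agree_le; lia.
Qed.

(** The maximum of finitely many bounds serves all; this is where boundedness of quantifiers
    enters. *)
Lemma finitary_uniform (Q : nat -> (nat -> Prop) -> Prop) k :
  (forall a, a < k -> finitary (Q a)) ->
  exists n, forall A B, agree n A B -> forall a, a < k -> (Q a A <-> Q a B).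
Proof.
  induction k as [|k IH]; intros H; [exists 0; intros; lia|].
  destruct IH as [m Hm]; [auto|]; destruct (H k) as [n Hn]; [lia|].
  exists (Nat.max m n); intros A B HAB a Ha.
  destruct (Nat.eq_dec a k) as [->|].
  - apply Hn; revert HAB; apply agree_le; lia.
  - apply Hm; [revert HAB; apply agree_le |]; lia.
Qed.

Lemma finitary_ball (Q : nat -> (nat -> Prop) -> Prop) k :
  (forall a, a < k -> finitary (Q a)) -> finitary (fun A => forall a, a < k -> Q a A).
Proof.
  intros H; destruct (finitary_uniform H) as [n Hn]; exists n; intros A B HAB.
  split; intros HQ a Ha; apply (Hn A B HAB a Ha), HQ, Ha.
Qed.

Lemma finitary_bex (Q : nat -> (nat -> Prop) -> Prop) k :
  (forall a, a < k -> finitary (Q a)) -> finitary (fun A => exists a, a < k /\ Q a A).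
Proof.
  intros H; destruct (finitary_uniform H) as [n Hn]; exists n; intros A B HAB.
  split; intros (a & Ha & HQ); exists a; split; auto; apply (Hn A B HAB a Ha), HQ.
Qed.

Lemma teval_tshift a v t : teval (vcons a v) (tshift t) = teval v t.
Proof. apply teval_tsubst. Qed.

(** Terms do not involve [P]: the bound of a quantifier is a number independent of [A], and an atom
    looks at a single value of [A]. *)
Lemma Delta0_finitary (d : formLAP) :
  Delta0 d -> forall v, finitary (fun A => sat (fun _ => A) v d).
Proof.
  induction 1; intros v; simpl.
  - exists 0; tauto.
  - exists 0; tauto.
  - exists 0; tauto.
  - exists (S (teval v t)); intros A B HAB; apply HAB; lia.
  - apply finitary_connective with (op := and); auto; tauto.
  - apply finitary_connective with (op := or); auto; tauto.
  - apply finitary_connective with (op := fun a b => a -> b); auto; tauto.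
  - apply finitary_ext with (Q := fun A => forall a, a < teval v t -> sat (fun _ => A) (vcons a v) p).
    + intros A; split; intros HA a; specialize (HA a); now rewrite teval_tshift in *.
    + apply finitary_ball; auto.
  - apply finitary_ext with (Q := fun A => exists a, a < teval v t /\ sat (fun _ => A) (vcons a v) p).
    + intros A; split; intros [a HA]; exists a; now rewrite teval_tshift in *.
    + apply finitary_bex; auto.
Qed.

(** A block of [n] universal quantifiers cut off at [m]; the cut-offs are the tests of the class. *)
Fixpoint ballN (n m : nat) (w : nat -> nat) (Q : (nat -> nat) -> Prop) : Prop :=
  match n with
  | 0 => Q w
  | S n => forall a, a < m -> ballN n m (vcons a w) Q
  end.

Lemma ballN_antitone n k m w Q : k <= m -> ballN n m w Q -> ballN n k w Q.
Proof.
  intros L; revert w; induction n as [|n IH]; simpl; auto.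
  intros w H a Ha; apply IH, H; lia.
Qed.

Lemma sat_AllN X (I : X -> nat -> Prop) n d : forall w,
  sat I w (AllN n d) <-> forall m, ballN n m w (fun w' => sat I w' d).
Proof.
  induction n as [|n IH]; intros w; simpl.
  - split; [auto | intros H; exact (H 0)].
  - split.
    + intros H m a _; now apply IH.
    + intros H a; apply IH; intros m.
      (* The cut-off is raised so that [a] itself falls below it. *)
      apply (@ballN_antitone n m (Nat.max m (S a))); [lia|].
      apply H; lia.
Qed.

Lemma finitary_ballN n m (Q : (nat -> Prop) -> (nat -> nat) -> Prop) :
  (forall w, finitary (fun A => Q A w)) -> forall w, finitary (fun A => ballN n m w (Q A)).
Proof.
  intros HQ; induction n as [|n IH]; intros w; simpl; auto.
  apply finitary_ball; auto.
Qed.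

Lemma definable_ballN (d : formLAP) n : forall m s w,
  definableF m -> definableF s -> (forall i, definableF (fun v => w v i)) ->
  definable (fun v => ballN n (m v) (w v) (fun w' => sat (fun _ x => mem x (s v)) w' d)).
Proof.
  induction n as [|n IH]; intros m s w Hm Hs Hw; simpl.
  - apply definable_sat; auto; apply definable_mem; apply definableF_var.
  - apply definable_all, definable_imp.
    + apply definable_lt; [apply definableF_var | now apply definableF_tail].
    + apply (IH (fun v => m (fun i => v (S i))) (fun v => s (fun i => v (S i)))
               (fun v => vcons (v 0) (w (fun i => v (S i))))).
      * now apply definableF_tail.
      * now apply definableF_tail.
      * intros [|i]; simpl; [apply definableF_var | exact (definableF_tail (Hw i))].
Qed.

(** The witnesses are numbers, so they can be kept while the interpretation of the symbols
    changes. *)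
Lemma sat_ExN_witness X m (p : form X) : forall (I : X -> nat -> Prop) v,
  sat I v (ExN m p) ->
  exists w, sat I w p /\ forall J : X -> nat -> Prop, sat J w p -> sat J v (ExN m p).
Proof.
  induction m as [|m IH]; intros I v H; [exists v; auto|].
  destruct H as [a H]; destruct (IH I _ H) as (w & Hw & Hback).
  exists w; split; [exact Hw|]; intros J HJ; exists a; now apply Hback.
Qed.

Lemma sat_eq_on X (I : X -> nat -> Prop) (p : form X) : forall n v w,
  bounded n p -> (forall i, i < n -> v i = w i) -> (sat I v p <-> sat I w p).
Proof.
  assert (Ht : forall n v w t, tbounded n t -> (forall i, i < n -> v i = w i) ->
               teval v t = teval w t).
  { intros n v w t Hb E; induction t; simpl in *; auto; destruct Hb; f_equal; auto. }
  assert (Hc : forall n v w a, (forall i, i < n -> v i = w i) ->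
               forall i, i < S n -> vcons a v i = vcons a w i).
  { intros n v w a E [|i] Hi; simpl; [reflexivity | apply E; lia]. }
  induction p; intros n v w Hb E; simpl in *.
  - reflexivity.
  - destruct Hb; now rewrite (Ht n v w s), (Ht n v w t).
  - destruct Hb; now rewrite (Ht n v w s), (Ht n v w t).
  - now rewrite (Ht n v w t).
  - destruct Hb; now rewrite (IHp1 n v w), (IHp2 n v w).
  - destruct Hb; now rewrite (IHp1 n v w), (IHp2 n v w).
  - destruct Hb; now rewrite (IHp1 n v w), (IHp2 n v w).
  - split; intros H a; apply (IHp (S n) _ _ Hb (Hc n v w a E)), H.
  - split; intros [a H]; exists a; apply (IHp (S n) _ _ Hb (Hc n v w a E)), H.
Qed.

Theorem Sigma2_arithmetical_model (alpha : formLAP) :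
  sentence alpha -> Sigma2 alpha -> has_standard_model alpha ->
  exists A, definable (fun v => A (v 0)) /\ models (fun _ => A) alpha.
Proof.
  intros Hs (m & n & d & Hd & ->) [I HI].
  assert (EI : I = fun _ => I P)
    by (apply functional_extensionality; now intros []).
  destruct (sat_ExN_witness (HI (fun _ => 0))) as (w & Hw & Hback).
  rewrite EI in Hw.
  destruct (@arithmetical_member (fun k A => ballN n k w (fun w' => sat (fun _ => A) w' d)))
    as (A & HA & HPhi).
  - intros k; apply finitary_ballN with (Q := fun A w' => sat (fun _ => A) w' d).
    now apply Delta0_finitary.
  - intros k l A; apply ballN_antitone.
  - apply (definable_ballN d n (m := fun v => v 0) (s := fun v => v 1) (w := fun _ => w)).
    + apply definableF_var.
    + apply definableF_var.
    (* The witness assignment is fixed, so each entry is a constant. *)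
    + intros i; apply definableF_const.
  - exists (I P); now apply sat_AllN.
  - exists A; split; [exact HA|].
    intros v; apply (@sat_eq_on _ _ _ 0 v (fun _ => 0) Hs); [lia|].
    now apply Hback, sat_AllN.
Qed.

(** * Contradiction with the undefinability of truth *)

Theorem mainTheorem3 (alpha : formLAP)
  (alpha_sentence : sentence alpha)
  (alpha_Sigma2 : Sigma2 alpha)
  (alpha_standard : has_standard_model alpha) :
  ~ theory_of_truth (ThN_plus alpha).
Proof.
  intros (_ & _ & Theta & _ & HTheta).
  destruct (Sigma2_arithmetical_model alpha_sentence alpha_Sigma2 alpha_standard)
    as (A & HA & Halpha).
  (* With [P] read as the arithmetical set [A], [Theta] defines an arithmetical set; the variables
     other than 0 get the value 0. *)
  apply (@truth_undefinable (fun x => sat (fun _ => A) (vcons x (fun _ => 0)) Theta)).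
  - apply (definable_sat (M := fun x _ => A x) Theta HA (s := fun _ => 0)).
    + apply definableF_const.
    + intros [|i]; simpl; [apply definableF_var | apply definableF_const].
  - intros s Hs; destruct (HTheta s Hs) as (G & HG & Hpr).
    assert (Hsat : sat (fun _ => A) (fun _ => 0)
                     (Iff (inst Theta (numeral (code s))) (embed symP s))).
    (* All axioms hold in the expansion of the standard model by [A], hence so does the proved
       equivalence. *)
    { apply (soundness Hpr); intros q Hq; destruct (HG q Hq) as [(p & [_ Hp] & ->)| ->].
      - apply sat_embed, Hp.
      - apply Halpha. }
    assert (Hv : models noRel s <-> sat noRel (fun _ => 0) s).
    { split; [auto | intros H v; revert H; apply (@sat_eq_on _ _ _ 0); [exact Hs | lia]]. }
    destruct Hsat as [H1 H2].
    simpl in H1, H2; rewrite sat_inst, teval_numeral, sat_embed in H1, H2.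
    rewrite Hv; split; assumption.
Qed.
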